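(* Let $\Lambda\subset\mathbb{R}^2$ be an irrational lattice generated by $\{(1,1),(-\Delta,-\widetilde\Delta)\}$, where $\Delta>1$ and $-1<\widetilde\Delta<0$ have continued fraction expansions $\Delta=[a_0,a_1,a_2,\dots]$ and $-\widetilde\Delta=[0,a_{-1},a_{-2},\dots]$ with all $a_k$ positive integers. For an integer $a\ge 1$ put $$L(a):=\frac{a}{4}+1+\frac{1}{a}-\frac{r}{4a},\qquad r\in\{0,1\},\ r\equiv a \pmod 2 .$$ Then for all $i\in\mathbb{Z}$ with $a_i>1$, $$L(a_i)<\max_{0\le j<a_i}\frac{\mathrm{Vol}(B_{A_i+j})}{\det(\Lambda)}<L(a_i+2)<L(a_i)+\frac12 .$$ In particular, $\Lambda$ has finite dispersion if and only if the continued fraction coefficients $(a_i)_{i\in\mathbb{Z}}$ are bounded.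
   Context: A lattice in $\mathbb{R}^2$ is the set $A\mathbb{Z}^2$ for an invertible real $2\times2$ matrix $A$ (the generators are the columns), and $\det(\Lambda)=|\det A|$. A lattice is irrational if no two of its distinct points lie on the same horizontal or vertical line. An empty box is an open axis-parallel box (a product of two open intervals) containing no point of $\Lambda$; it is maximal if it is not properly contained in another empty box. The dispersion $\mathrm{disp}(\Lambda)\in(0,\infty]$ is the supremum of the areas of all empty boxes. A maximal empty box is bounded from below by $(0,0)$ if $(0,0)$ lies in the relative interior of its bottom side. The set of maximal empty boxes bounded from below by $(0,0)$ is indexed as $\{B_n: n\in\mathbb{Z}\}$ in increasing order of height, with $B_0=(-\Delta,1)\times(0,1-\widetilde\Delta)$, which is one of these boxes. Finally $A_i=\sum_{k=0}^{i-1}a_k$ for $i\ge0$ and $A_i=-\sum_{k=i}^{-1}a_k$ for $i<0$. *)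

(* Defs.v *)
From HB Require Import structures.
From mathcomp Require Import all_boot all_order all_algebra.
From mathcomp Require Import all_classical all_reals all_analysis.

Set Implicit Arguments.
Unset Strict Implicit.
Unset Printing Implicit Defensive.

Import Order.TTheory GRing.Theory Num.Theory.
Import numFieldNormedType.Exports.

Local Open Scope classical_set_scope.
Local Open Scope ring_scope.

Definition gen_mx (R : realType) (u v : R * R) : 'M[R]_2 :=
  \matrix_(i < 2, j < 2)
    (let p := if j == 0 then u else v in if i == 0 then p.1 else p.2).

Definition lattice (R : realType) (A : 'M[R]_2) : set (R * R) :=
  [set ((A *m map_mx intr z) 0 0, (A *m map_mx intr z) 1 0)
     | z in [set: 'cV[int]_2]].

(* The determinant of [lattice A]; it depends on [A] only through the
   lattice, since two bases differ by a matrix in GL_2(Z). *)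
Definition lattice_det (R : realType) (A : 'M[R]_2) : R := `|\det A|.

Definition irrational_lattice (R : realType) (L : set (R * R)) : Prop :=
  forall p q, L p -> L q -> p <> q -> p.1 <> q.1 /\ p.2 <> q.2.

(* Boxes are recorded by the endpoints of their sides, so that the height and
   the bottom side are determined. Nondegeneracy is part of [empty_box]; on
   nondegenerate boxes [box_set] is injective. *)
Record box (R : realType) := Box { xmin : R; xmax : R; ymin : R; ymax : R }.

Definition box_set (R : realType) (b : box R) : set (R * R) :=
  `]xmin b, xmax b[%classic `*` `]ymin b, ymax b[%classic.

Definition height (R : realType) (b : box R) : R := ymax b - ymin b.

Definition vol (R : realType) (b : box R) : \bar R :=
  ((@lebesgue_measure R) \x (@lebesgue_measure R))%E (box_set b).

Definition empty_box (R : realType) (L : set (R * R)) (b : box R) : Prop :=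
  [/\ xmin b < xmax b, ymin b < ymax b & box_set b `&` L = set0].

Definition maximal_empty_box (R : realType) (L : set (R * R)) (b : box R) :
    Prop :=
  empty_box L b /\
  forall b', empty_box L b' -> ~ (box_set b `<` box_set b').

Definition dispersion (R : realType) (L : set (R * R)) : \bar R :=
  ereal_sup [set vol b | b in [set b | empty_box L b]].

Definition bounded_below_by_origin (R : realType) (b : box R) : Prop :=
  ymin b = 0 /\ xmin b < 0 < xmax b.

Definition box_indexing (R : realType) (L : set (R * R)) (b0 : box R)
    (B : int -> box R) : Prop :=
  [/\ range B =
        [set b | maximal_empty_box L b /\ bounded_below_by_origin b],
      forall m n : int, m < n -> height (B m) < height (B n)
    & B 0 = b0].

(* [cfrac R c n] is the finite continued fraction [c 0; c 1, ..., c n]. *)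
Fixpoint cfrac (R : realType) (c : nat -> nat) (n : nat) : R :=
  if n is m.+1 then (c 0%N)%:R + (cfrac R (fun k => c k.+1) m)^-1
  else (c 0%N)%:R.

Definition has_cfrac (R : realType) (x : R) (c : nat -> nat) : Prop :=
  cfrac R c n @[n --> \oo] --> x.

(* [Negz k] is the integer -(k+1), so the second branch ranges over the
   indices -(n+1), ..., -1. *)
Definition partial_sum (a : int -> nat) (i : int) : int :=
  match i with
  | Posz n => \sum_(k < n) (a (Posz k))%:Z
  | Negz n => - \sum_(k < n.+1) (a (Negz k))%:Z
  end.

Definition Lbound (R : realType) (a : nat) : R :=
  a%:R / 4 + 1 + 1 / a%:R - (odd a)%:R / (4 * a%:R).

(* Main.v *)
Require Import Defs.
From HB Require Import structures.
From mathcomp Require Import all_boot all_order all_algebra.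
From mathcomp Require Import all_classical all_reals all_analysis.
From mathcomp Require Import ring lra zify.

Set Implicit Arguments.
Unset Strict Implicit.
Unset Printing Implicit Defensive.

Import Order.TTheory GRing.Theory Num.Theory.
Import numFieldNormedType.Exports.

Local Open Scope classical_set_scope.
Local Open Scope ring_scope.

(** The maximal empty boxes above the origin form a staircase governed by the
    two-sided continued fraction. Put [e_(-1) = (-Delta, -tDelta)],
    [e_0 = (1, 1)] and [e_(i+1) = e_(i-1) + a_i e_i] for all integers [i].
    As [a_i] is the integer part of the ratio of consecutive abscissas (for
    [i >= 0]) or ordinates (for [i < 0]), this is the Euclidean algorithm run
    forwards on the abscissas of the basis and backwards on its ordinates. Hence
    the abscissas of the [e_i] alternate in sign and decrease in modulus while the
    ordinates are positive and increase ([reduced_linrec]), and consecutive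
    vectors form a basis of the lattice ([basis_linrec]).

    A basis [p, q] of the lattice on opposite sides of the vertical axis in
    the upper half plane spans a box with [p] and [q] on its vertical sides
    and [p + q] on top. It is maximal empty ([spanned_box_maximal]), and the
    next higher maximal box is obtained by replacing one vector by [p + q],
    with nothing in between ([spanned_box_gap]). Taking [p = e_(i-1) + j e_i]
    and [q = e_i] for [0 <= j <= a_i] gives row [i] of the staircase, whose
    last box is the first of row [i + 1]. Since the given [B_0] is the first
    box of row 0, counting steps yields that [B_(A_i + j)] is the [j]-th box
    of row [i] ([stair_box_indexed]).

    Let [D = [a_i; a_(i+1), ...]] and [t = [0; a_(i-1), ...]] be the ratios of
    abscissas and of ordinates of [e_(i-1)] and [e_i]. Then the area of this
    box divided by the determinant is [(D - j + 1) (t + j + 1) / (D + t)]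
    ([vol_stair_box]). Here [a_i < D < a_i + 1] and [0 < t < 1]. The bounds
    [Lbound (a_i)] and [Lbound (a_i + 2)] are the largest values over [j] at
    the two extreme corners, [D = a_i, t = 0] and [D = a_i + 1, t = 1]
    ([area_ratio_lower], [area_ratio_upper]).

    For the dispersion, the central box of row [i] shows that [a_i] is at most
    a constant times the dispersion ([coefficient_le]). Conversely an empty
    box anywhere in the plane cannot exceed a spanned box in both directions,
    since it would contain a lattice parallelogram ([empty_box_narrow]);
    comparing it with the row whose height it just exceeds bounds its area in
    terms of [a_i] ([vol_empty_box_le]). *)

(** * Integer indexings *)

(** Boxes and lattice vectors are indexed by all integers starting from a
    known one at 0, so statements have to be propagated in both directions. *)
Lemma int_bi_ind (P : int -> Prop) :
  P 0 -> (forall i, P i -> P (i + 1)) -> (forall i, P (i + 1) -> P i) ->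
  forall i, P i.
Proof.
move=> P0 PS PP; elim/int_ind => // n IHn.
  by rewrite -addn1 PoszD; exact: PS.
by apply: PP; have -> : - n.+1%:Z + 1 = - n%:Z by lia.
Qed.

Lemma int_crossing (R : realType) (f : int -> R) (h : R) (k n : nat) :
  f (- k%:Z) < h -> h <= f n -> exists i, f i < h <= f (i + 1).
Proof.
move=> fk fn; suff: forall m : nat, h <= f (- k%:Z + m%:Z) ->
    exists i, f i < h <= f (i + 1).
  by move/(_ (k + n)%N); apply; rewrite PoszD addKr.
elim=> [|m IHm]; first by rewrite addr0 leNgt fk.
have [/IHm//|lt_m le_mS] := leP h (f (- k%:Z + m%:Z)).
exists (- k%:Z + m%:Z); rewrite lt_m/=.
by have -> : - k%:Z + m%:Z + 1 = - k%:Z + m.+1%:Z by lia.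
Qed.

(** A strictly increasing enumeration by [int] leaves no room for an index
    between two elements whose values have nothing in between, so such
    elements carry consecutive indices. This identifies the boxes of an
    arbitrary indexing from purely local information, without knowing
    beforehand that all maximal boxes have been listed. *)
Lemma enum_covering (R : realType) (T : Type) (h : T -> R) (B : int -> T)
    (s t : T) :
  (forall m n : int, m < n -> h (B m) < h (B n)) ->
  range B s -> range B t -> h s < h t ->
  (forall u, range B u -> h s < h u -> h t <= h u) ->
  forall m, B m = s <-> B (m + 1) = t.
Proof.
move=> hB [k _ <-] [l _ <-] lt_kl gap m.
have Blt (i j : int) : (h (B i) < h (B j)) = (i < j).
  apply/idP/idP; last exact: hB.
  by case: (ltgtP i j) => [//|/hB lt_ji /(lt_trans lt_ji)|->]; rewrite ltxx.
have Binj (i j : int) : B i = B j -> i = j.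
  by case: (ltgtP i j) => // /hB + eB; rewrite eB ltxx.
have l_eq : l = k + 1.
  have := gap (B (k + 1)) (imageT B _); rewrite leNgt !Blt => gap1.
  by move: lt_kl gap1; rewrite Blt; lia.
split=> [/Binj->|/Binj eml]; first by rewrite l_eq.
by congr B; lia.
Qed.

Lemma partial_sumS (c : int -> nat) (i : int) :
  partial_sum c (i + 1) = partial_sum c i + (c i)%:Z.
Proof.
case: i => [n|[|n]].
- by rewrite -PoszD addn1 /= big_ord_recr.
- by rewrite /= big_ord0 big_ord_recr big_ord0 /= add0r addNr.
- have -> : Negz n.+1 + 1 = Negz n by lia.
  by rewrite /= [in RHS]big_ord_recr /= opprD -addrA addNr addr0.
Qed.

(** * Two-sided linear recurrences *)

(** The two-sided sequence [e] with [e (-1) = p], [e 0 = q] and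
    [e (i + 1) = e (i - 1) + c i * e i]. Both halves are computed by iterating
    on a pair of neighbours: [rec_up n] is [(e (n - 1), e n)] and [rec_down n]
    is [(e (- n - 1), e (- n))]. *)
Section Linrec.
Variables (R : realType) (c : int -> nat) (p q : R).

Fixpoint rec_up (n : nat) : R * R :=
  if n is m.+1 then let s := rec_up m in (s.2, s.1 + s.2 *+ c (Posz m))
  else (p, q).

Fixpoint rec_down (n : nat) : R * R :=
  if n is m.+1 then let s := rec_down m in (s.2 - s.1 *+ c (Negz m), s.1)
  else (p, q).

Definition linrec (i : int) : R :=
  match i with Posz n => (rec_up n).2 | Negz n => (rec_down n).1 end.

Lemma linrecS (i : int) :
  linrec (i + 1) = linrec (i - 1) + linrec i *+ c i.
Proof.
case: i => [[|n]|[|n]] //.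
- rewrite -PoszD addn1.
  by have -> : n.+1%:Z - 1 = n by lia.
- by rewrite /= subrK.
- have -> : Negz n.+1 + 1 = Negz n by lia.
  have -> : Negz n.+1 - 1 = Negz n.+2 by lia.
  by rewrite /= subrK.
Qed.

End Linrec.

(** * The normalized area *)

(** In this form the numerator is four times the largest product [(P * Q)] of
    two integers with [P + Q = a + 2]. *)
Lemma Lbound_eq (R : realType) (a : nat) : (0 < a)%N ->
  Lbound R a = ((a%:R + 2) ^+ 2 - (odd a)%:R) / (4 * a%:R).
Proof.
move=> a0; rewrite /Lbound; field.
by rewrite pnatr_eq0 -lt0n.
Qed.

Lemma Lbound_increment (R : realType) (a : nat) : (0 < a)%N ->
  Lbound R (a + 2) < Lbound R a + 1 / 2.
Proof.
move=> a0; rewrite /Lbound oddD addbF natrD -subr_gt0.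
have a1 : 1 <= a%:R :> R by rewrite ler1n.
have r1 : (odd a)%:R <= 1 :> R by rewrite lern1 leq_b1.
set r := (odd a)%:R in r1 *.
have a_neq0 : a%:R != 0 :> R by lra.
have a2_neq0 : a%:R + 2 != 0 :> R by lra.
set d := (X in 0 < X).
have -> : d = (4 - r) / (2 * (a%:R * (a%:R + 2))).
  by rewrite /d; field; apply/andP.
by rewrite divr_gt0 ?mulr_gt0 //; lra.
Qed.

(** The normalized area of a box of the staircase, as a function of the
    complete quotient D = [a_i; a_(i+1), ...], of t =
    [0; a_(i-1), a_(i-2), ...] and of the position of the box in its row. *)
Definition area_ratio (R : realType) (D t : R) (j : nat) : R :=
  (D - j%:R + 1) * (t + j%:R + 1) / (D + t).

(** At the corner [D = a], [t = 0] the central index [a./2] gives exactly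
    [Lbound a], and for [D > a] and [t > 0] the ratio at this index is
    increasing in both. *)
Lemma area_ratio_lower (R : realType) (D t : R) (a : nat) :
  (1 < a)%N -> a%:R < D -> 0 < t -> Lbound R a < area_ratio D t a./2.
Proof.
move=> a1 aD t0; rewrite Lbound_eq ?(ltnW a1)// /area_ratio.
have h1 : 1 <= a./2%:R :> R by rewrite ler1n half_gt0.
have ea : a%:R = (odd a)%:R + 2 * a./2%:R :> R.
  by rewrite -[in LHS](odd_double_half a) natrD -muln2 natrM mulrC.
move: aD; rewrite ea; set h := a./2%:R in h1 * => aD.
have -> : D = (odd a)%:R + 2 * h + (D - ((odd a)%:R + 2 * h)) by ring.
have : 0 < D - ((odd a)%:R + 2 * h) by rewrite subr_gt0.
move: (D - _) => x x0; have hh : 0 <= h * (h - 1) by apply: mulr_ge0; lra.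
have [xt xh th] : [/\ 0 < x * t, 0 < x * h & 0 < t * h].
  by split; apply: mulr_gt0; lra.
have [xhh thh xth] :
    [/\ 0 <= x * (h * (h - 1)), 0 <= t * (h * (h - 1)) & 0 < x * t * h].
  by split; [apply: mulr_ge0|apply: mulr_ge0|apply: mulr_gt0]; lra.
case: (odd a) => /=; rewrite ltr_pdivrMr; try lra.
  by rewrite mulrAC ltr_pdivlMr; last lra; nra.
by rewrite mulrAC ltr_pdivlMr; last lra; nra.
Qed.

(** With [P = a + 2 - j] and [Q = j + 2] the ratio lies below its value
    [P Q / (a + 2)] at the corner [D = a + 1], [t = 1]. As [P + Q = a + 4],
    this value is at most [Lbound (a + 2)] by the arithmetic-geometric
    inequality for integers, which is strict when [P + Q] is odd; this is
    where the parity term comes from. *)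
Lemma area_ratio_upper (R : realType) (D t : R) (a j : nat) :
  (1 < a)%N -> (j < a)%N -> a%:R < D < a%:R + 1 -> 0 < t < 1 ->
  area_ratio D t j < Lbound R (a + 2).
Proof.
move=> a1 ja /andP[aD Da] /andP[t0 t1].
set P : nat := (a + 2 - j)%N.
have aE : (a + 2 = P + j)%N by rewrite subnK//; lia.
have P3 : (3 <= P)%N by lia.
have sq : 4 * (P%:R * (j%:R + 2)) <=
    (P%:R + j%:R + 2) ^+ 2 - (odd (P + j))%:R :> R.
  rewrite lerBrDr.
  have -> : 4 * (P%:R * (j%:R + 2)) + (odd (P + j))%:R =
    (4 * (P * (j + 2)) + odd (P + j))%:R :> R by rewrite !(natrD, natrM).
  have -> : (P%:R + j%:R + 2) ^+ 2 = ((P + j + 2) ^ 2)%:R :> R.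
    by rewrite natrX !natrD.
  rewrite ler_nat.
  have AGM := nat_AGM2 P (j + 2); rewrite -addnA.
  case: (boolP (odd (P + j))) => [odd_Pj|_]; last by rewrite addn0 AGM.
  rewrite addn1 (ltn_leqif AGM); apply: contraL odd_Pj => /eqP->.
  by rewrite -addnA addnCA !oddD addbb.
rewrite Lbound_eq ?addn2// -addn2 /area_ratio.
have -> : (a + 2)%:R + 2 = P%:R + j%:R + 2 :> R by rewrite aE natrD.
have -> : odd (a + 2) = odd (P + j) by rewrite aE.
have P3R : 3 <= P%:R :> R by rewrite (ler_nat _ 3).
have j0 : 0 <= j%:R :> R by [].
have aPj : a%:R = P%:R + j%:R - 2 :> R.
  by move: (congr1 (fun n => n%:R : R) aE); rewrite /= !natrD; lra.
have -> : (a + 2)%:R = P%:R + j%:R :> R by rewrite aE natrD.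
apply: (@lt_le_trans _ _ (P%:R * (j%:R + 2) / (P%:R + j%:R))); last first.
  rewrite ler_pdivrMr; last lra.
  rewrite [leRHS](_ : _ = ((P%:R + j%:R + 2) ^+ 2 - (odd (P + j))%:R) / 4).
    by lra.
  by field; lra.
rewrite ltr_pdivrMr; last lra.
rewrite mulrAC ltr_pdivlMr; last lra.
move: aD Da t0 t1; rewrite aPj => aD Da t0 t1.
(* Distances to the corner, in which the inequality becomes
   xi tau (P + Q - 2) < xi Q (Q - 2) + tau P (P - 2),
   true as xi, tau < 1, P >= 3 and Q >= 2. *)
have : exists2 xi, 0 < xi < 1 & D = P%:R + j%:R - 1 - xi.
  by exists (P%:R + j%:R - 1 - D); lra.
case=> xi xi01 ->.
have : exists2 tau, 0 < tau < 1 & t = 1 - tau by exists (1 - t); lra.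
case=> tau tau01 ->.
have xt : xi * tau * j%:R <= xi * ((j%:R + 2) * j%:R).
  by rewrite -mulrA ler_wpM2l ?ler_wpM2r//; lra.
have tx : xi * tau * P%:R < tau * (P%:R * (P%:R - 2)).
  by rewrite (mulrC xi) -mulrA ltr_pM2l 1?mulrC ?ltr_pM2l; lra.
lra.
Qed.

(** * Continued fractions and complete quotients *)

Lemma cfrac_itv (R : realType) (c : nat -> nat) (n : nat) :
  (forall k, 0 < c k.+1)%N -> (c 0)%:R <= cfrac R c n <= (c 0)%:R + 1.
Proof.
elim: n c => [|n IHn] c c_gt0 /=; first by rewrite lexx lerDl ler01.
have /andP[tail_ge _] := IHn (fun k => c k.+1) (fun k => c_gt0 k.+1).
have tail_ge1 : 1 <= cfrac R (fun k => c k.+1) n.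
  by apply: le_trans tail_ge; rewrite ler1n.
have tail_gt0 := lt_le_trans ltr01 tail_ge1.
by rewrite lerDl lerD2l invr_ge0 invf_le1// tail_ge1 ltW.
Qed.

(** The infinite value of a continued fraction is only known as a limit; this
    is the passage to the limit in [x = c 0 + 1 / x']. Inversion is continuous
    there because the tails are at most [c 1 + 1], which keeps [x] away from
    [c 0]. *)
Lemma has_cfrac_tail (R : realType) (x : R) (c : nat -> nat) :
  (forall k, 0 < c k.+1)%N -> has_cfrac x c ->
  (c 0)%:R < x /\ has_cfrac (x - (c 0)%:R)^-1 (fun k => c k.+1).
Proof.
move=> c_gt0 xc.
pose tail n := cfrac R (fun k => c k.+1) n.
have tailE n : tail n = (cfrac R c n.+1 - (c 0)%:R)^-1.
  by rewrite /= addrC addKr invrK.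
have xcS : cfrac R c n.+1 - (c 0)%:R @[n --> \oo] --> x - (c 0)%:R.
  by apply: cvgB; [rewrite (cvg_shiftS (cfrac R c))|exact: cvg_cst].
have x_gt : 0 < x - (c 0)%:R.
  apply: (@lt_le_trans _ _ ((c 1%N)%:R + 1)^-1).
    by rewrite invr_gt0 ltr_wpDl.
  rewrite -(cvg_lim (@Rhausdorff R) xcS).
  apply: limr_ge; first by apply/cvg_ex; exists (x - (c 0)%:R).
  near=> n; rewrite -[leRHS]invrK -tailE.
  have /andP[tail_ge tail_le] :=
    @cfrac_itv R (fun k => c k.+1) n (fun k => c_gt0 k.+1).
  rewrite lef_pV2 ?posrE ?ltr_wpDl//.
  by apply: lt_le_trans tail_ge; rewrite ltr0n.
split; first by rewrite -subr_gt0.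
rewrite /has_cfrac (_ : cfrac R _ = (fun n => (cfrac R c n.+1 - (c 0)%:R)^-1)).
  by apply: cvgV => //; rewrite gt_eqF.
by apply/funext.
Unshelve. all: by end_near. Qed.

Lemma has_cfrac_itv (R : realType) (x : R) (c : nat -> nat) :
  (forall k, 0 < c k.+1)%N -> has_cfrac x c ->
  (c 0)%:R < x < (c 0)%:R + 1.
Proof.
move=> c_gt0 xc; have [x_gt xcS] := has_cfrac_tail c_gt0 xc.
rewrite x_gt/= -ltrBlDl -invf_gt1 ?subr_gt0//.
have [+ _] := has_cfrac_tail (fun k => c_gt0 k.+1) xcS.
by apply: le_lt_trans; rewrite ler1n.
Qed.

(** * Boxes spanned by a basis *)

Definition lattice_basis (R : realType) (L : set (R * R)) (p q : R * R) :
    Prop :=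
  forall z, L z <-> exists m n : int,
    z = (p.1 * m%:~R + q.1 * n%:~R, p.2 * m%:~R + q.2 * n%:~R).

(** Vectors of the upper half plane on opposite sides of the vertical axis. *)
Definition opposed (R : realType) (p q : R * R) : Prop :=
  [/\ p.1 * q.1 < 0, 0 < p.2 & 0 < q.2].

(** The open box with [p] and [q] on its vertical sides, [p + q] on its top
    side and the origin on its bottom side. It is symmetric in [p] and [q], so
    the side on which each of them lies need not be tracked. *)
Definition spanned_box (R : realType) (p q : R * R) : box R :=
  Box (Num.min p.1 q.1) (Num.max p.1 q.1) 0 (p.2 + q.2).

Section Boxes.
Variables (R : realType) (L : set (R * R)).
Implicit Types (p q z : R * R) (b : box R).

Lemma lattice_basisC p q : lattice_basis L p q -> lattice_basis L q p.
Proof.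
by move=> Lpq z; rewrite Lpq; split=> -[m [n ->]]; exists n, m;
  rewrite addrC [in X in (_, X)]addrC.
Qed.

Lemma opposedC p q : opposed p q -> opposed q p.
Proof. by case=> *; split=> //; rewrite mulrC. Qed.

Lemma spanned_boxC p q : spanned_box p q = spanned_box q p.
Proof. by rewrite /spanned_box minC maxC addrC. Qed.

Lemma lattice_basis_shear p q (k : int) :
  lattice_basis L p q ->
  lattice_basis L (p.1 + q.1 * k%:~R, p.2 + q.2 * k%:~R) q.
Proof.
move=> Lpq z; rewrite Lpq; split=> -[m [n ->]] /=.
  by exists m, (n - k * m); rewrite intrB intrM; congr pair;
    move: (m%:~R) (n%:~R) (k%:~R) => u v w; ring.
by exists m, (n + k * m); rewrite intrD intrM; congr pair;
  move: (m%:~R) (n%:~R) (k%:~R) => u v w; ring.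
Qed.

Lemma lattice_basis_next p q (k : int) : lattice_basis L p q ->
  lattice_basis L q (p.1 + q.1 * k%:~R, p.2 + q.2 * k%:~R).
Proof. by move=> Lpq; exact: (lattice_basisC (lattice_basis_shear k Lpq)). Qed.

Lemma opposed_sign p q : opposed p q -> p.1 < 0 < q.1 \/ q.1 < 0 < p.1.
Proof.
case=> pq_lt0 _ _; have [q1_gt0|q1_lt0|q1_0] := ltrgt0P q.1.
- by left; rewrite andbT -(pmulr_llt0 _ q1_gt0).
- by right; rewrite -(nmulr_llt0 _ q1_lt0).
- by move: pq_lt0; rewrite q1_0 mulr0 ltxx.
Qed.

Lemma in_box_set b z :
  box_set b z <-> xmin b < z.1 < xmax b /\ ymin b < z.2 < ymax b.
Proof.
by rewrite /box_set; split=> -[/= z1 z2]; split;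
  move: z1 z2; rewrite /= !in_itv.
Qed.

Lemma empty_boxP b :
  empty_box L b <-> [/\ xmin b < xmax b, ymin b < ymax b &
    forall z, L z -> xmin b < z.1 < xmax b -> ymin b < z.2 < ymax b -> False].
Proof.
split=> -[bx by_ bL]; split=> //.
  move=> z Lz z1 z2; suff: (box_set b `&` L) z by rewrite bL.
  by split => //; apply/in_box_set.
by rewrite -subset0 => z [/in_box_set[z1 z2] Lz]; apply: bL Lz z1 z2.
Qed.

Lemma lattice_basis_mem p q : lattice_basis L p q ->
  [/\ L p, L q, L (p.1 + q.1, p.2 + q.2) & L (0, 0)].
Proof.
move=> Lpq; split; apply/Lpq.
- by exists 1, 0; rewrite !(mulr1z, mulr0z, mulr1, mulr0) !addr0; case: p {Lpq}.
- by exists 0, 1; rewrite !(mulr1z, mulr0z, mulr1, mulr0) !add0r; case: q {Lpq}.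
- by exists 1, 1; rewrite !mulr1z !mulr1.
- by exists 0, 0; rewrite !mulr0z !mulr0 addr0.
Qed.

(** The point [m p + n q] is too high if [m, n > 0], too low if [m, n <= 0],
    and beyond the side through [p] or the one through [q] in the mixed
    cases. *)
Lemma spanned_box_empty p q :
  lattice_basis L p q -> opposed p q -> empty_box L (spanned_box p q).
Proof.
move=> Lpq opq; wlog sgn : p q Lpq opq / p.1 < 0 < q.1 => [W|].
  have [|sgn] := opposed_sign opq; first exact: W.
  rewrite spanned_boxC; apply: W => //; first exact: lattice_basisC.
  exact: opposedC.
have [_ p2 q2] := opq; have /andP[p1 q1] := sgn.
apply/empty_boxP; rewrite /= min_l ?max_r; [|lra..].
split; [lra|lra|move=> _ /Lpq[m [n ->]] /=].
have [m1|m0] := ltP 0 m; have [n1|n0] := ltP 0 n.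
- move=> _ /andP[_]; apply/negP; rewrite -leNgt.
  have: 1 <= m%:~R :> R by rewrite ler1z.
  have: 1 <= n%:~R :> R by rewrite ler1z.
  by nra.
- move=> /andP[+ _] _; apply/negP; rewrite -leNgt.
  have: 1 <= m%:~R :> R by rewrite ler1z.
  have: n%:~R <= 0 :> R by rewrite lerz0.
  by nra.
- move=> /andP[_ +] _; apply/negP; rewrite -leNgt.
  have: m%:~R <= 0 :> R by rewrite lerz0.
  have: 1 <= n%:~R :> R by rewrite ler1z.
  by nra.
- move=> _ /andP[+ _]; apply/negP; rewrite -leNgt.
  have: m%:~R <= 0 :> R by rewrite lerz0.
  have: n%:~R <= 0 :> R by rewrite lerz0.
  by nra.
Qed.

Lemma empty_box_not_in b z : empty_box L b -> L z ->
  xmin b < z.1 < xmax b -> 0 < z.2 -> ymin b = 0 -> ymax b <= z.2.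
Proof.
move=> /empty_boxP[_ _ bL] Lz z1 z2 y0; rewrite leNgt; apply/negP => z2_lt.
by apply: bL Lz z1 _; rewrite y0 z2.
Qed.

Lemma box_set_subset b b' : xmin b < xmax b -> ymin b < ymax b ->
  (box_set b `<=` box_set b' <->
   [/\ xmin b' <= xmin b, xmax b <= xmax b', ymin b' <= ymin b &
      ymax b <= ymax b']).
Proof.
move=> bx by_; split=> [sub|[x0 x1 y0 y1] z].
  have {}sub z : xmin b < z.1 < xmax b -> ymin b < z.2 < ymax b ->
      xmin b' < z.1 < xmax b' /\ ymin b' < z.2 < ymax b'.
    by move=> z1 z2; apply/in_box_set/sub/in_box_set.
  split; rewrite leNgt; apply/negP => lt.
  - pose u := Num.min (xmin b') (xmax b).
    have u1 : xmin b < u by rewrite lt_min lt bx.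
    have u2 : u <= xmin b' by rewrite ge_min lexx.
    have u3 : u <= xmax b by rewrite ge_min lexx orbT.
    by have := sub ((xmin b + u) / 2, (ymin b + ymax b) / 2); rewrite /=; lra.
  - pose u := Num.max (xmax b') (xmin b).
    have u1 : u < xmax b by rewrite gt_max lt bx.
    have u2 : xmax b' <= u by rewrite le_max lexx.
    have u3 : xmin b <= u by rewrite le_max lexx orbT.
    by have := sub ((xmax b + u) / 2, (ymin b + ymax b) / 2); rewrite /=; lra.
  - pose u := Num.min (ymin b') (ymax b).
    have u1 : ymin b < u by rewrite lt_min lt by_.
    have u2 : u <= ymin b' by rewrite ge_min lexx.
    have u3 : u <= ymax b by rewrite ge_min lexx orbT.
    by have := sub ((xmin b + xmax b) / 2, (ymin b + u) / 2); rewrite /=; lra.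
  - pose u := Num.max (ymax b') (ymin b).
    have u1 : u < ymax b by rewrite gt_max lt by_.
    have u2 : ymax b' <= u by rewrite le_max lexx.
    have u3 : ymin b <= u by rewrite le_max lexx orbT.
    by have := sub ((xmin b + xmax b) / 2, (ymax b + u) / 2); rewrite /=; lra.
by move=> /in_box_set[z1 z2]; apply/in_box_set; lra.
Qed.

(** Each side contains a lattice point in its relative interior, namely [p],
    [q], [p + q] and the origin, so no side can be moved outwards. *)
Lemma spanned_box_maximal p q :
  lattice_basis L p q -> opposed p q -> maximal_empty_box L (spanned_box p q).
Proof.
move=> Lpq opq; split; first exact: spanned_box_empty.
wlog sgn : p q Lpq opq / p.1 < 0 < q.1 => [W|].
  have [|sgn] := opposed_sign opq; first exact: W.
  rewrite spanned_boxC; apply: W => //; first exact: lattice_basisC.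
  exact: opposedC.
have [_ p2 q2] := opq; have /andP[p1 q1] := sgn.
have sbE : spanned_box p q = Box p.1 q.1 0 (p.2 + q.2).
  by rewrite /spanned_box min_l ?max_r//; lra.
move=> b' /empty_boxP[bx by_ bL] []; rewrite sbE.
move=> /box_set_subset /= /(_ _ _)[||x0 x1 y0 y1]; [lra|lra|].
have [Lp Lq Ls L0] := lattice_basis_mem Lpq.
apply; apply/box_set_subset => //=; split; rewrite leNgt; apply/negP => lt.
- by apply: bL Lp _ _; lra.
- by apply: bL Lq _ _; lra.
- by apply: bL L0 _ _; rewrite /=; lra.
- by apply: bL Ls _ _; rewrite /=; lra.
Qed.

Lemma spanned_box_bounded_below p q :
  opposed p q -> bounded_below_by_origin (spanned_box p q).
Proof.
move=> opq; split=> //=; rewrite gt_min lt_max.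
by case: (opposed_sign opq) => /andP[-> ->]; rewrite ?orbT.
Qed.

(** Replacing [p] by [p + q] gives the next maximal box. A box of strictly
    intermediate height would be squeezed horizontally between [q] and
    [p + q], hence properly contained in the empty box spanned by these
    two. *)
Lemma spanned_box_gap p q b :
  lattice_basis L p q -> opposed p q -> opposed (p.1 + q.1, p.2 + q.2) q ->
  maximal_empty_box L b -> bounded_below_by_origin b ->
  height (spanned_box p q) < height b ->
  height (spanned_box (p.1 + q.1, p.2 + q.2) q) <= height b.
Proof.
move=> Lpq opq osq [bE bmax] [y0 /andP[xmin_lt xmax_gt]].
rewrite /height /= y0 !subr0 => lt_b; rewrite leNgt; apply/negP => b_lt.
have [_ Lq Ls _] := lattice_basis_mem Lpq.
have Lsq : lattice_basis L (p.1 + q.1, p.2 + q.2) q.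
  by have := lattice_basis_shear 1 Lpq; rewrite mulr1z !mulr1.
apply: (bmax _ (spanned_box_empty Lsq osq)).
have [_ p2 q2] := opq.
have bx : xmin b < xmax b by lra.
have avoid z : L z -> 0 < z.2 -> z.2 < ymax b ->
    xmax b <= z.1 \/ z.1 <= xmin b.
  move=> Lz z2 z2_lt; have [|x1] := leP (xmax b) z.1; first by left.
  have [|x0] := leP z.1 (xmin b); first by right.
  have := empty_box_not_in bE Lz _ z2 y0; rewrite x0 x1 => /(_ isT).
  by rewrite leNgt z2_lt.
have by_ : ymin b < ymax b by rewrite y0; lra.
split; last first.
  case/box_set_subset; rewrite /= ?y0; [|lra|lra].
  by have /empty_boxP[] := spanned_box_empty Lsq osq.
apply/box_set_subset => //=; rewrite y0.
have qA : xmax b <= q.1 \/ q.1 <= xmin b by apply: (avoid _ Lq); lra.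
have sA : xmax b <= p.1 + q.1 \/ p.1 + q.1 <= xmin b.
  by apply: (avoid _ Ls) => /=; lra.
case: (opposed_sign osq) => /= /andP[sgn1 sgn2].
  by rewrite min_l ?max_r; [split|..]; lra.
by rewrite min_r ?max_l; [split|..]; lra.
Qed.

(** Every translate of the half-open parallelogram on [p] and [q] contains a
    lattice point, and its bounding box is a translate of the spanned box.
    Hence an empty box cannot exceed the spanned box in both width and
    height. *)
Lemma empty_box_narrow p q b : lattice_basis L p q -> opposed p q ->
  empty_box L b -> height (spanned_box p q) < height b ->
  xmax b - xmin b <= xmax (spanned_box p q) - xmin (spanned_box p q).
Proof.
move=> Lpq opq bE; wlog sgn : p q Lpq opq / p.1 < 0 < q.1 => [W|].
  have [|sgn] := opposed_sign opq; first exact: W.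
  rewrite spanned_boxC; apply: W => //; first exact: lattice_basisC.
  exact: opposedC.
have [_ p2 q2] := opq; have /andP[p1 q1] := sgn.
rewrite /height /= subr0 min_l ?max_r; [|lra..].
move=> h_lt; rewrite leNgt; apply/negP => w_lt.
have d_gt0 : 0 < q.1 * p.2 - p.1 * q.2.
  by rewrite subr_gt0 (@lt_trans _ _ 0) ?mulr_gt0 ?pmulr_llt0.
(* The corner of the parallelogram is placed so that its bounding box is
   centred in b; s and t are the coordinates of this corner. *)
pose z1 := (xmin b + xmax b - p.1 - q.1) / 2.
pose z2 := (ymin b + ymax b - p.2 - q.2) / 2.
pose s := (q.1 * z2 - q.2 * z1) / (q.1 * p.2 - p.1 * q.2).
pose t := (p.2 * z1 - p.1 * z2) / (q.1 * p.2 - p.1 * q.2).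
have z1E : z1 = p.1 * s + q.1 * t by rewrite /s /t; field; rewrite gt_eqF.
have z2E : z2 = p.2 * s + q.2 * t by rewrite /s /t; field; rewrite gt_eqF.
have /andP[] := ceil_itv s; have /andP[] := ceil_itv t.
rewrite !intrB; set n := Num.ceil t; set m := Num.ceil s => n_lt n_ge m_lt m_ge.
have [_ _ +] := (empty_boxP b).1 bE.
apply; first by apply/Lpq; exists m, n; reflexivity.
  rewrite /=.
  have : p.1 <= p.1 * (m%:~R - s) + q.1 * (n%:~R - t) <= q.1 by nra.
  by move: z1E; rewrite /z1; lra.
rewrite /=.
have : 0 <= p.2 * (m%:~R - s) + q.2 * (n%:~R - t) <= p.2 + q.2 by nra.
by move: z2E; rewrite /z2; lra.
Qed.

Lemma vol_box b : xmin b <= xmax b -> ymin b <= ymax b ->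
  vol b = ((xmax b - xmin b) * height b)%:E.
Proof.
move=> bx by_; rewrite /vol /box_set product_measure1E//.
have itvE (u v : R) : u <= v -> lebesgue_measure `]u, v[%classic = (v - u)%:E.
  move=> uv; rewrite lebesgue_measure_itv /= lte_fin.
  have [_|vu] := ltP u v; first by rewrite EFinB.
  by rewrite (_ : v = u) ?subrr//; lra.
by rewrite EFinM; congr (_ * _)%E; exact: itvE.
Qed.

Lemma spanned_box_width p q :
  xmax (spanned_box p q) - xmin (spanned_box p q) = `|p.1 - q.1|.
Proof.
rewrite /=; have [pq|pq] := leP p.1 q.1.
  by rewrite ler0_norm; lra.
by rewrite gtr0_norm; lra.
Qed.

Lemma vol_spanned_box p q : opposed p q ->
  vol (spanned_box p q) = (`|p.1 - q.1| * (p.2 + q.2))%:E.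
Proof.
case=> _ p2 q2; rewrite vol_box ?spanned_box_width /height /= ?subr0//;
  last lra.
by rewrite -subr_ge0 spanned_box_width.
Qed.

End Boxes.

(** * The lattice vectors of the continued fraction *)

(** Coordinates of two consecutive vectors of the sequence, abscissas [x', x]
    and ordinates [y', y]: the abscissas alternate in sign and decrease in
    modulus, the ordinates are positive and increase. Given the first
    condition, the second says [`|x| < `|x'|]. *)
Definition reduced (R : realType) (x' x y' y : R) : Prop :=
  [/\ x' * x < 0, 0 < x' * (x' + x), 0 < y' & y' < y].

(** The coefficient is the integer part of [- x' / x], so the new abscissa is
    the remainder of the division of [x'] by [x], with the sign of [x']. The
    ordinates only add up. *)
Lemma reduced_next (R : realType) (x' x y' y : R) (c : nat) :
  reduced x' x y' y -> (0 < c)%N -> c%:R < - x' / x < c%:R + 1 ->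
  reduced x (x' + x *+ c) y (y' + y *+ c).
Proof.
move=> [xx _ y'0 yy] c0 cx; have c1 : 1 <= c%:R :> R by rewrite ler1n.
have x_neq0 : x != 0 by apply: contraTneq xx => ->; rewrite mulr0 ltxx.
have x2 : 0 < x * x by rewrite -expr2 exprn_even_gt0.
have x'E : x' = - (- x' / x) * x by field.
rewrite -(mulr_natr x) -(mulr_natr y) x'E.
move: (- x' / x) cx => D /andP[cD Dc].
split; [| |lra|nra].
- have -> : x * (- D * x + x * c%:R) = (x * x) * (c%:R - D) by ring.
  by rewrite pmulr_rlt0// subr_lt0.
- have -> : x * (x + (- D * x + x * c%:R)) = (x * x) * (c%:R + 1 - D) by ring.
  by rewrite mulr_gt0// subr_gt0.
Qed.

(** Backwards the roles are exchanged: the ordinates undergo Euclidean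
    division, while the abscissas have opposite signs and their moduli add
    up. *)
Lemma reduced_prev (R : realType) (x' x y' y : R) (c : nat) :
  reduced x' x y' y -> (0 < c)%N -> c%:R < y / y' < c%:R + 1 ->
  reduced (x - x' *+ c) x' (y - y' *+ c) y'.
Proof.
move=> [xx xs y'0 yy] c0; have c1 : 1 <= c%:R :> R by rewrite ler1n.
rewrite ltr_pdivlMr// ltr_pdivrMr// -(mulr_natr x') -(mulr_natr y').
move=> /andP[cy yc].
have x'x' : 0 < x' * x' by move: xs; rewrite mulrDr; lra.
have xc : x' * x' <= x' * x' * c%:R by rewrite ler_peMr// ltW.
by split; nra.
Qed.

Section Staircase.
Variables (R : realType) (Delta tDelta : R) (a : int -> nat).
Hypotheses (Delta_gt1 : 1 < Delta) (tDelta_itv : -1 < tDelta < 0).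
Hypothesis a_gt0 : forall k : int, (0 < a k)%N.
Hypothesis Delta_cfrac : has_cfrac Delta (fun n => a (Posz n)).
Hypothesis tDelta_cfrac :
  has_cfrac (- tDelta) (fun n => if n is m.+1 then a (Negz m) else 0%N).

(** The lattice points [(x i, y i)] start from the given basis, with
    [(-Delta, -tDelta)] at index -1 and [(1, 1)] at index 0. *)
Let L := lattice (gen_mx (1, 1) (- Delta, - tDelta)).
Let x := linrec a (- Delta) 1.
Let y := linrec a (- tDelta) 1.

Lemma xS i : x (i + 1) = x (i - 1) + x i *+ a i.
Proof. exact: linrecS. Qed.

Lemma yS i : y (i + 1) = y (i - 1) + y i *+ a i.
Proof. exact: linrecS. Qed.

(** For nonnegative indices positivity of the remainders comes from the
    expansion of [Delta], whose tails are the ratios of consecutive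
    abscissas. *)
Lemma reduced_up (n : nat) :
  reduced (x (n%:Z - 1)) (x n) (y (n%:Z - 1)) (y n) /\
  has_cfrac (- x (n%:Z - 1) / x n) (fun k => a (n + k)%N).
Proof.
elim: n => [|n [redn cfn]].
  rewrite sub0r /x /y /=; split; last by rewrite opprK divr1.
  have D1 := Delta_gt1; have t1 := tDelta_itv.
  by split; [lra|rewrite mulNr oppr_gt0 pmulr_rlt0; lra|lra|lra].
have c_gt0 (k : nat) : (0 < a (n + k.+1)%N)%N by [].
have := has_cfrac_itv c_gt0 cfn; rewrite addn0 => D_itv.
have [_ cfS] := has_cfrac_tail c_gt0 cfn.
have eS : n.+1%:Z = n%:Z + 1 by rewrite -PoszD addn1.
rewrite eS addrK xS yS; split; first exact: reduced_next.
move: cfS; rewrite addn0.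
rewrite (_ : (fun k => a (n + k.+1)%N) = (fun k => a (n.+1 + k)%N)); last first.
  by apply/funext => k; rewrite addnS.
have [xx _ _ _] := redn; have x_neq0 : x n != 0.
  by apply: contraTneq xx => ->; rewrite mulr0 ltxx.
congr has_cfrac; rewrite -mulr_natr -[RHS]invf_div; congr _^-1.
by field.
Qed.

(** For nonpositive indices it comes from the expansion of [- tDelta], read on
    the ordinates. *)
Lemma reduced_down (n : nat) :
  reduced (x (- n%:Z - 1)) (x (- n%:Z)) (y (- n%:Z - 1)) (y (- n%:Z)) /\
  has_cfrac (y (- n%:Z) / y (- n%:Z - 1)) (fun k => a (Negz (n + k))).
Proof.
elim: n => [|n [redn cfn]].
  split; first by have [] := reduced_up 0.
  have [//|_] := has_cfrac_tail _ tDelta_cfrac.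
  by rewrite mulr0n subr0 oppr0 sub0r /y /= mul1r.
have c_gt0 (k : nat) : (0 < a (Negz (n + k.+1)))%N by [].
have := has_cfrac_itv c_gt0 cfn; rewrite addn0 => D_itv.
have [_ cfS] := has_cfrac_tail c_gt0 cfn.
have eS : - n.+1%:Z = - n%:Z - 1 by lia.
have eN : Negz n = - n%:Z - 1 by lia.
have xP : x (- n%:Z - 1 - 1) = x (- n%:Z) - x (- n%:Z - 1) *+ a (Negz n).
  by apply/eqP; rewrite eq_sym subr_eq eN -xS subrK.
have yP : y (- n%:Z - 1 - 1) = y (- n%:Z) - y (- n%:Z - 1) *+ a (Negz n).
  by apply/eqP; rewrite eq_sym subr_eq eN -yS subrK.
rewrite eS xP yP; split; first exact: reduced_prev.
move: cfS; rewrite addn0.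
rewrite (_ : (fun k => a (Negz (n + k.+1))) = (fun k => a (Negz (n.+1 + k)))).
  congr has_cfrac; have [_ _ y'0 yy] := redn.
  rewrite -mulr_natr -[RHS]invf_div; congr _^-1.
  by field; rewrite gt_eqF.
by apply/funext => k; rewrite addnS.
Qed.

Lemma reduced_linrec (i : int) : reduced (x (i - 1)) (x i) (y (i - 1)) (y i).
Proof.
case: i => n; first by case: (reduced_up n).
by rewrite NegzE; case: (reduced_down n.+1).
Qed.

Definition xquot (i : int) : R := - x (i - 1) / x i.
Definition yquot (i : int) : R := y (i - 1) / y i.

Lemma x_neq0 (i : int) : x i != 0.
Proof.
have [xx _ _ _] := reduced_linrec i.
by apply: contraTneq xx => ->; rewrite mulr0 ltxx.
Qed.

Lemma y_gt0 (i : int) : 0 < y i.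
Proof. by have [_ _ y'0 yy] := reduced_linrec i; apply: lt_trans yy. Qed.

Lemma x_predE (i : int) : x (i - 1) = - xquot i * x i.
Proof. by rewrite /xquot; field; rewrite x_neq0. Qed.

Lemma y_predE (i : int) : y (i - 1) = yquot i * y i.
Proof. by rewrite /yquot divfK// gt_eqF// y_gt0. Qed.

Lemma xquot_itv (i : int) : (a i)%:R < xquot i < (a i)%:R + 1.
Proof.
have [+ + _ _] := reduced_linrec (i + 1).
rewrite addrK xS x_predE -(mulr_natr (x i)).
have x2 : 0 < x i * x i by rewrite -expr2 exprn_even_gt0// x_neq0.
have -> : x i * (- xquot i * x i + x i * (a i)%:R) =
  (x i * x i) * ((a i)%:R - xquot i) by ring.
have -> : x i * (x i + (- xquot i * x i + x i * (a i)%:R)) =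
  (x i * x i) * ((a i)%:R + 1 - xquot i) by ring.
by rewrite pmulr_rlt0// pmulr_rgt0// subr_lt0 subr_gt0 => -> ->.
Qed.

Lemma yquot_itv (i : int) : 0 < yquot i < 1.
Proof.
have [_ _ y'0 yy] := reduced_linrec i.
by rewrite /yquot divr_gt0 ?y_gt0//= ltr_pdivrMr ?y_gt0// mul1r.
Qed.

(** * The staircase of boxes *)

(** For [0 <= j <= a i] these points lie on the segment from
    [(x (i - 1), y (i - 1))] to [(x (i + 1), y (i + 1))], all on the side of
    the vertical axis opposite to [(x i, y i)]. *)
Definition seg_pt (i : int) (j : nat) : R * R :=
  (x (i - 1) + x i *+ j, y (i - 1) + y i *+ j).

Lemma seg_pt0 i : seg_pt i 0 = (x (i - 1), y (i - 1)).
Proof. by rewrite /seg_pt !addr0. Qed.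

Lemma basis_linrec (i : int) :
  lattice_basis L (x (i - 1), y (i - 1)) (x i, y i).
Proof.
elim/int_bi_ind: i => [|i Li|i].
- move=> z; rewrite sub0r /x /y /=; split.
    move=> [v _ <-]; exists (v 1 0), (v 0 0).
    rewrite !mxE !big_ord_recl !big_ord0 !mxE /=.
    rewrite !addr0 (_ : lift ord0 ord0 = 1); last exact: val_inj.
    by congr pair; rewrite addrC.
  move=> [m [n ->]]; exists (\col_(i < 2) if i == 0 then n else m) => //.
  rewrite !mxE !big_ord_recl !big_ord0 !mxE /=.
  by rewrite !addr0; congr pair; rewrite addrC.
- rewrite addrK xS yS -(mulr_natr (x i)) -(mulr_natr (y i)).
  exact: (lattice_basis_next (a i) Li).
- rewrite addrK => Li.
  have := lattice_basisC (lattice_basis_next (- (a i)%:Z) (lattice_basisC Li)).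
  by rewrite intrN !mulrN !mulr_natr xS yS !addrK.
Qed.

Lemma basis_seg_pt i j : lattice_basis L (seg_pt i j) (x i, y i).
Proof.
by have := lattice_basis_shear j (basis_linrec i); rewrite /= !mulr_natr.
Qed.

Lemma opposed_seg_pt i j : (j <= a i)%N -> opposed (seg_pt i j) (x i, y i).
Proof.
move=> ja; have /andP[D_gt _] := xquot_itv i.
have /andP[t_gt0 _] := yquot_itv i.
have y0 := y_gt0 i; have y'0 : 0 < y (i - 1) by rewrite y_predE mulr_gt0.
split => //=; last by rewrite ltr_wpDr// mulrn_wge0// ltW.
rewrite x_predE -mulr_natr (_ : _ * _ = (x i * x i) * (j%:R - xquot i)).
  rewrite pmulr_rlt0 -?expr2 ?exprn_even_gt0 ?x_neq0// subr_lt0.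
  by apply: le_lt_trans D_gt; rewrite ler_nat.
by ring.
Qed.

Definition stair_box i j : box R := spanned_box (seg_pt i j) (x i, y i).

(** The end of row [i] is the beginning of row [i + 1]: this joins the rows
    into one sequence, in which row [i] occupies the indices [A_i + j]. *)
Lemma stair_box_last i : stair_box i (a i) = stair_box (i + 1) 0.
Proof.
by rewrite /stair_box seg_pt0 addrK spanned_boxC /seg_pt
  xS yS.
Qed.

Lemma stair_box0 : stair_box 0 0 = Box (- Delta) 1 0 (1 - tDelta).
Proof.
have D1 := Delta_gt1.
rewrite /stair_box seg_pt0 sub0r /x /y /spanned_box /=.
by rewrite min_l ?max_r ?[1 - _]addrC//; lra.
Qed.

Lemma height_stair_box i j :
  height (stair_box i j) = y (i - 1) + y i *+ j + y i.
Proof. by rewrite /height /= subr0. Qed.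

(** Consecutive boxes of the sequence have no maximal box of intermediate
    height, so any indexing that agrees with the sequence at 0 agrees with it
    everywhere. *)
Lemma stair_box_indexed (B : int -> box R) :
  box_indexing L (Box (- Delta) 1 0 (1 - tDelta)) B ->
  forall i j, (j <= a i)%N -> B (partial_sum a i + j%:Z) = stair_box i j.
Proof.
move=> [rangeB B_lt B0].
have stair_in i j : (j <= a i)%N -> range B (stair_box i j).
  move=> /opposed_seg_pt opp; rewrite rangeB; split.
    exact: spanned_box_maximal (basis_seg_pt i j) opp.
  exact: spanned_box_bounded_below opp.
have covering i j m : (j < a i)%N ->
    B m = stair_box i j <-> B (m + 1) = stair_box i j.+1.
  move=> ja; apply: (enum_covering B_lt); try exact: stair_in (ltnW ja).
  - exact: stair_in ja.
  - by rewrite !height_stair_box mulrSr; have := y_gt0 i; lra.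
  move=> b; rewrite rangeB => -[bmax b0] lt_b.
  have vS : seg_pt i j.+1 = ((seg_pt i j).1 + x i, (seg_pt i j).2 + y i).
    by rewrite /seg_pt !mulrSr !addrA.
  rewrite /stair_box vS.
  apply: (spanned_box_gap (basis_seg_pt i j) (opposed_seg_pt (ltnW ja))) => //.
  by have := opposed_seg_pt ja; rewrite vS.
have row i j m : (j <= a i)%N ->
    B m = stair_box i 0 <-> B (m + j%:Z) = stair_box i j.
  elim: j => [|j IHj] ja; first by rewrite addr0.
  by rewrite (IHj (ltnW ja)) covering// -addrA -PoszD addn1.
have col i : B (partial_sum a i) = stair_box i 0.
  elim/int_bi_ind: i => [|i|i].
  - by rewrite /= big_ord0 B0 stair_box0.
  - by move/(row _ _ _ (leqnn _)); rewrite -partial_sumS stair_box_last.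
  - by rewrite partial_sumS -stair_box_last => /(row _ _ _ (leqnn _)).
by move=> i j ja; apply/row.
Qed.

Lemma lattice_detE :
  lattice_det (gen_mx (1, 1) (- Delta, - tDelta)) = Delta - tDelta.
Proof.
have D1 := Delta_gt1; have t1 := tDelta_itv.
rewrite /lattice_det (expand_det_row _ 0) !big_ord_recl big_ord0 /cofactor.
rewrite !det_mx11 !mxE /= /bump /= !expr0 !mul1r expr1.
by rewrite ger0_norm; lra.
Qed.

(** Up to sign, the cross product of [(x (i - 1), y (i - 1))] and [(x i, y i)]
    does not depend on [i], and at index 0 it is the determinant of the given
    basis. *)
Lemma lattice_det_quot (i : int) :
  lattice_det (gen_mx (1, 1) (- Delta, - tDelta)) =
  `|x i| * y i * (xquot i + yquot i).
Proof.
have normE k : `|x (k - 1) * y k - x k * y (k - 1)| =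
    `|x k| * y k * (xquot k + yquot k).
  rewrite x_predE y_predE.
  have -> : - xquot k * x k * y k - x k * (yquot k * y k) =
    - (x k * (y k * (xquot k + yquot k))) by ring.
  have := xquot_itv k; have := yquot_itv k; have := y_gt0 k.
  have : 0 <= (a k)%:R :> R by [].
  move=> *; rewrite normrN normrM -mulrA (@ger0_norm _ (_ * _))//.
  by rewrite mulr_ge0; lra.
rewrite -normE; elim/int_bi_ind: i => [|i IHi|i].
- have D1 := Delta_gt1; have t1 := tDelta_itv.
  by rewrite sub0r /x /y /= lattice_detE ler0_norm; lra.
- rewrite IHi addrK xS yS -normrN.
  by congr `|_|; rewrite -(mulr_natr (x i)) -(mulr_natr (y i)); ring.
- rewrite addrK xS yS => ->.
  rewrite -normrN -(mulr_natr (x i)) -(mulr_natr (y i)).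
  by congr `|_|; ring.
Qed.

Lemma lattice_det_gt0 : 0 < lattice_det (gen_mx (1, 1) (- Delta, - tDelta)).
Proof.
by rewrite lattice_detE; have D1 := Delta_gt1; have t1 := tDelta_itv; lra.
Qed.

Lemma vol_stair_box i j : (j <= a i)%N ->
  vol (stair_box i j) = (area_ratio (xquot i) (yquot i) j *
    lattice_det (gen_mx (1, 1) (- Delta, - tDelta)))%:E.
Proof.
move=> ja; rewrite (vol_spanned_box (opposed_seg_pt ja)) (lattice_det_quot i).
congr EFin; have /andP[D_gt _] := xquot_itv i.
have /andP[t_gt0 _] := yquot_itv i.
have jD : j%:R <= (a i)%:R :> R by rewrite ler_nat.
rewrite /= x_predE y_predE -(mulr_natr (x i)) -(mulr_natr (y i)).
have -> : - xquot i * x i + x i * j%:R - x i =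
  - (x i * (xquot i - j%:R + 1)) by ring.
rewrite normrN normrM (@ger0_norm _ (_ + 1)); last lra.
have j0 : 0 <= j%:R :> R by [].
by rewrite /area_ratio; field; lra.
Qed.

Lemma max_area_bounds (B : int -> box R) (i : int) :
  box_indexing L (Box (- Delta) 1 0 (1 - tDelta)) B -> (1 < a i)%N ->
  let M := \big[Num.max/0]_(j < a i)
    (fine (vol (B (partial_sum a i + j%:Z))) /
     lattice_det (gen_mx (1, 1) (- Delta, - tDelta))) in
  Lbound R (a i) < M < Lbound R (a i + 2).
Proof.
move=> idxB a1 /=; set M := (\big[Num.max/0]_(j < a i) _).
have det0 := lattice_det_gt0.
have /andP[D_gt D_lt] := xquot_itv i; have /andP[t_gt0 t_lt1] := yquot_itv i.
have a0 : 0 <= (a i)%:R :> R by [].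
have ME : M = \big[Num.max/0]_(j < a i) area_ratio (xquot i) (yquot i) j.
  apply: eq_bigr => j _; rewrite stair_box_indexed ?(ltnW (ltn_ord j))//.
  by rewrite vol_stair_box ?(ltnW (ltn_ord j))//= mulfK// gt_eqF.
have upper (j : nat) : (j < a i)%N ->
    area_ratio (xquot i) (yquot i) j < Lbound R (a i + 2).
  by move=> ja; apply: area_ratio_upper; rewrite ?D_gt ?t_gt0.
rewrite ME; apply/andP; split.
  have ha : ((a i)./2 < a i)%N by rewrite ltn_half_double -addnn; lia.
  have := le_bigmax 0 (fun j : 'I_(a i) => area_ratio (xquot i) (yquot i) j)
    (Ordinal ha).
  by apply: lt_le_trans; apply: area_ratio_lower.
apply: bigmax_lt => [|j _]; last exact: upper.
apply: le_lt_trans (upper 0%N (a_gt0 i)).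
by rewrite /area_ratio mulr0n divr_ge0 ?mulr_ge0//; lra.
Qed.

(** * Dispersion *)

(** [y (i + 2) >= y (i + 1) + y i >= 2 * y i]. Read upwards from 0 it shows
    that the heights are unbounded, read from [- 2 n] up to 0 that they come
    close to 0. *)
Lemma y_growth i (n : nat) : y i * 2 ^+ n <= y (i + (2 * n)%N%:Z).
Proof.
elim: n => [|n IHn]; first by rewrite expr0 mulr1 muln0 addr0.
have -> : i + (2 * n.+1)%N%:Z = (i + (2 * n)%N%:Z + 1) + 1 by lia.
set k : int := i + (2 * n)%N%:Z in IHn *.
have [_ _ _ yk] := reduced_linrec (k + 1); rewrite addrK in yk.
have ya : y (k + 1) <= y (k + 1) *+ a (k + 1).
  by rewrite -[leLHS]mulr1n ler_wpMn2l // ltW// y_gt0.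
rewrite yS addrK exprSr mulrA; move: (y i * 2 ^+ n) IHn => u IHn.
by lra.
Qed.

Lemma height_crossing (h : R) : 0 < h ->
  exists i, height (stair_box i 0) < h <= height (stair_box (i + 1) 0).
Proof.
move=> h_gt0; pose H i := height (stair_box i 0).
have y_lt_H i : y i < H i.
  have [_ _ y'0 _] := reduced_linrec i.
  by rewrite /H height_stair_box addr0 ltrDr.
have H_lt_y i : H i < y i * 2.
  have [_ _ _ yy] := reduced_linrec i.
  by rewrite /H height_stair_box addr0 mulr_natr mulr2n ltrD2r.
have pow2_gt u : exists n, u < 2 ^+ n :> R.
  exists (Num.truncn u).+1; apply: lt_le_trans (truncnS_gt u) _.
  by rewrite -natrX ler_nat ltnW// ltn_expl.
have [m m_gt] := pow2_gt (2 / h); have [n n_gt] := pow2_gt h.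
have y0 : y 0 = 1 by [].
apply: (@int_crossing _ H h (2 * m) (2 * n)).
  apply: lt_trans (H_lt_y _) _.
  have := y_growth (- (2 * m)%N%:Z) m; rewrite addNr y0.
  rewrite ltr_pdivrMr// in m_gt; have := y_gt0 (- (2 * m)%N%:Z).
  move: (y _) => u u_gt0 um.
  have pow_gt0 : 0 < 2 ^+ m :> R by rewrite exprn_gt0.
  rewrite -(ltr_pM2r pow_gt0); lra.
apply/ltW/(lt_trans n_gt)/le_lt_trans/y_lt_H.
by have := y_growth 0 n; rewrite y0 mul1r add0r.
Qed.

(** If the height of [b] lies between those of the first boxes of rows [i] and
    [i + 1], then [b] is not wider than the former; so its area is at most the
    width of the one times the height of the other, which exceeds the
    determinant by a factor of order [a i]. *)
Lemma vol_empty_box_le (N : nat) (b : box R) :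
  (forall i, (a i <= N)%N) -> empty_box L b ->
  (vol b <= (2 * (N%:R + 2) *
     lattice_det (gen_mx (1, 1) (- Delta, - tDelta)))%:E)%E.
Proof.
move=> aN bE; have [bx by_ _] := bE.
have h_gt0 : 0 < height b by rewrite subr_gt0.
have [i /andP[h_gt h_le]] := height_crossing h_gt0.
have opp := opposed_seg_pt (leq0n (a i)).
have := empty_box_narrow (basis_seg_pt i 0) opp bE h_gt.
rewrite spanned_box_width seg_pt0 /=.
move: h_le; rewrite height_stair_box addr0.
rewrite addrK yS x_predE y_predE -(mulr_natr (y i)) => h_le.
have /andP[D_gt _] := xquot_itv i; have /andP[t_gt0 t_lt1] := yquot_itv i.
have a_ge1 : 1 <= (a i)%:R :> R by rewrite ler1n.
have a_leN : (a i)%:R <= N%:R :> R by rewrite ler_nat.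
have y0 := y_gt0 i.
have -> : - xquot i * x i - x i = - (x i * (xquot i + 1)) by ring.
rewrite normrN normrM (@ger0_norm _ (_ + 1)); last lra.
move=> w_le; rewrite vol_box ?(ltW bx) ?(ltW by_)// lee_fin.
have w_le' : xmax b - xmin b <= `|x i| * (2 * xquot i).
  by apply: le_trans w_le _; rewrite ler_wpM2l//; lra.
have h_le' : height b <= y i * (N%:R + 2) by nra.
apply: (le_trans (ler_pM _ (ltW h_gt0) w_le' h_le')).
  by rewrite subr_ge0 ltW.
rewrite (lattice_det_quot i) [leRHS](_ : _ =
  `|x i| * y i * (2 * (N%:R + 2)) * (xquot i + yquot i)); last by ring.
rewrite [leLHS](_ : _ = `|x i| * y i * (2 * (N%:R + 2)) * xquot i);
  last by ring.
rewrite ler_wpM2l ?mulr_ge0 ?(ltW y0)//; lra.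
Qed.

(** The central box of row [i] is empty of area more than [a i / 4]
    determinants. *)
Lemma coefficient_le (r : R) (i : int) :
  (forall b, empty_box L b -> (vol b <= r%:E)%E) ->
  (a i)%:R <= Num.max 1
    (4 * r / lattice_det (gen_mx (1, 1) (- Delta, - tDelta))).
Proof.
move=> vol_le; rewrite le_max; have [a_le1|a_gt1] := leqP (a i) 1.
  by rewrite lern1 a_le1.
apply/orP; right; rewrite ler_pdivlMr ?lattice_det_gt0//.
have ha : ((a i)./2 <= a i)%N by rewrite leq_half_double -addnn; lia.
have := vol_le _ (spanned_box_empty (basis_seg_pt i _)
  (opposed_seg_pt ha)).
rewrite vol_stair_box// lee_fin.
have /andP[D_gt _] := xquot_itv i; have /andP[t_gt0 _] := yquot_itv i.
have lower := area_ratio_lower a_gt1 D_gt t_gt0.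
have a1 : 1 < (a i)%:R :> R by rewrite ltr1n.
have : (a i)%:R / 4 <= Lbound R (a i).
  rewrite /Lbound -!addrA lerDl.
  have o1 : (odd (a i))%:R <= 1 :> R by rewrite lern1 leq_b1.
  have : (odd (a i))%:R / (4 * (a i)%:R) <= 1 :> R.
    by rewrite ler_pdivrMr; lra.
  have : 0 < 1 / (a i)%:R :> R by rewrite divr_gt0; lra.
  by lra.
move: (area_ratio _ _ _) lower (lattice_det _) lattice_det_gt0.
move=> rho rho_gt d d0 rho_le a4.
have : 0 < (rho - (a i)%:R / 4) * d by rewrite mulr_gt0// subr_gt0; lra.
by lra.
Qed.

Lemma dispersion_finite :
  (dispersion L < +oo)%E <-> exists N : nat, forall i : int, (a i <= N)%N.
Proof.
split=> [disp_fin|[N aN]]; last first.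
  apply: le_lt_trans (ltry (2 * (N%:R + 2) *
    lattice_det (gen_mx (1, 1) (- Delta, - tDelta)))).
  by apply: ge_ereal_sup => _ [b bE <-]; exact: vol_empty_box_le.
have [r vol_le] : exists r, forall b, empty_box L b -> (vol b <= r%:E)%E.
  have le_disp b : empty_box L b -> (vol b <= dispersion L)%E.
    by move=> bE; apply: ereal_sup_ubound; exists b.
  case: (dispersion L) disp_fin le_disp => [r _ le_r|//|_ le_ninfty].
    by exists r.
  by exists 0 => b /le_ninfty /le_trans; apply; rewrite leNye.
set u := Num.max 1 (4 * r / lattice_det (gen_mx (1, 1) (- Delta, - tDelta))).
exists (Num.truncn u) => i; rewrite -ltnS -(ltr_nat R).
exact: le_lt_trans (coefficient_le i vol_le) (truncnS_gt u).
Qed.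

End Staircase.

(** * The bounds and the criterion for finite dispersion *)

Theorem theorem3p14 (R : realType) (Delta tDelta : R) (a : int -> nat)
    (Delta_gt1 : 1 < Delta)
    (tDelta_bounds : -1 < tDelta < 0)
    (a_gt0 : forall k : int, (0 < a k)%N)
    (Delta_cfrac : has_cfrac Delta (fun n => a (Posz n)))
    (tDelta_cfrac :
      has_cfrac (- tDelta) (fun n => if n is m.+1 then a (Negz m) else 0%N))
    (irrL :
      irrational_lattice (lattice (gen_mx (1, 1) (- Delta, - tDelta)))) :
  let A := gen_mx (1, 1) (- Delta, - tDelta) in
  (forall B : int -> box R,
     box_indexing (lattice A) (Box (- Delta) 1 0 (1 - tDelta)) B ->
     forall i : int, (1 < a i)%N ->
       let M := \big[Num.max/0]_(j < a i)
                  (fine (vol (B (partial_sum a i + j%:Z))) / lattice_det A) in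
       [/\ Lbound R (a i) < M,
           M < Lbound R (a i + 2)
         & Lbound R (a i + 2) < Lbound R (a i) + 1 / 2])
  /\ ((dispersion (lattice A) < +oo)%E <->
      exists N : nat, forall i : int, (a i <= N)%N).
Proof.
move=> A; split; last exact: dispersion_finite.
move=> B idxB i a_gt1 M.
have [M_gt M_lt] := andP (max_area_bounds Delta_gt1 tDelta_bounds a_gt0
  Delta_cfrac tDelta_cfrac idxB a_gt1).
by split => //; apply: Lbound_increment.
Qed.
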